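(* Let $g(|x_i|)$ be strictly concave, increasing and differentiable in its domain $D\subseteq\mathbb{R}_+$ (for $|x_i|=0$, the right derivative is considered). Let $A\in\mathbb{R}^{m\times n}$, $y\in\mathbb{R}^m$, $\lambda>0$, and let $$\mathcal{F}:X\times Y\to\mathbb{R},\quad X\subseteq\mathbb{R}^n,\ Y\subseteq\mathbb{R}_+^n,\qquad \mathcal{F}(x,w):=\frac12\|y-Ax\|_2^2+\lambda\sum_{i=1}^n\bigl[w_i|x_i|+h(w_i)\bigr],$$ where $h:H\subseteq\mathbb{R}_+\to\mathbb{R}_+$ is defined by $h'=-(g')^{-1}$, with $(\cdot)^{-1}$ indicating the inverse function. Assume that $X$ and $Y$ are closed, and that the (weighted) Lasso problem in the Lasso IRL1 algorithm (defined in the context) has a unique solution. Then the Lasso IRL1 algorithm achieves a partial optimum of $\mathcal{F}$. Moreover, the iterates of the algorithm numerically converge, that is, $$\lim_{t\to\infty}\bigl\|(x(t+1),w(t+1))-(x(t),w(t))\bigr\|_2=0.$$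
   Context: $\mathbb{R}_+=[0,+\infty)$. The function $h$ is determined by $h'=-(g')^{-1}$ up to an integration constant, which can be set arbitrarily. Partial optimum: $(x^\star,w^\star)\in X\times Y$ is a partial optimum of $\mathcal{F}$ on $X\times Y$ if $\mathcal{F}(x^\star,w^\star)\le\mathcal{F}(x,w^\star)$ for any $x\in X$ and $\mathcal{F}(x^\star,w^\star)\le\mathcal{F}(x^\star,w)$ for any $w\in Y$. Lasso IRL1 algorithm: given $x(0)\in\mathbb{R}^n$ and $\lambda>0$, for $t=0,1,2,\dots$ set $w_i(t)=g'(|x_i(t)|)$ for any $i\in\{1,\dots,n\}$, and let $x(t+1)$ be the solution of the weighted Lasso problem $$x(t+1)=\operatorname{argmin}_{x\in\mathbb{R}^n}\ \frac12\|y-Ax\|_2^2+\lambda\sum_{i=1}^n w_i(t)|x_i|.$$ *)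

(* Defs.v *)
From mathcomp Require Import all_boot all_order all_algebra.
From mathcomp Require Import all_classical all_reals all_analysis.

Set Implicit Arguments.
Unset Strict Implicit.
Unset Printing Implicit Defensive.

Import Order.TTheory GRing.Theory Num.Theory.
Import numFieldNormedType.Exports.

Local Open Scope classical_set_scope.
Local Open Scope ring_scope.

Section OneVariable.
Variable R : realType.
Implicit Types (D : set R) (f : R -> R).

Definition strictly_concave_on D f : Prop :=
  is_interval D /\
  forall a b t : R, D a -> D b -> a != b -> 0 < t < 1 ->
    t * f a + (1 - t) * f b < f (t * a + (1 - t) * b).

Definition strictly_increasing_on D f : Prop :=
  forall a b : R, D a -> D b -> a < b -> f a < f b.

(* Derivative of f relative to its domain D: the increments stay in D, so this
   is the usual derivative in the interior of D and the one-sided derivative at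
   an endpoint belonging to D; in particular, it is the right derivative at 0
   if D is contained in [0, +oo[. *)
Definition diff_quot f (x u : R) : R := (f u - f x) / (u - x).

Definition derive_in D f (x : R) : R :=
  lim (diff_quot f x u @[u --> within D x^']).

(* Without the limit point condition, the filter could be trivial. *)
Definition derivable_in D f (x : R) : Prop :=
  limit_point D x /\ cvg (diff_quot f x u @[u --> within D x^']).

(* The image g'(D), that is, the domain of (g')^-1. *)
Definition derive_range D (g : R -> R) : set R := derive_in D g @` D.

(* h' = - (g')^-1 on g'(D); [pinv D f] is the inverse of f : D -> f(D). *)
Definition neg_inverse_derivative D (g h : R -> R) : Prop :=
  forall v, derive_range D g v ->
    derivable_in (derive_range D g) h v /\
    derive_in (derive_range D g) h v = - pinv D (derive_in D g) v.

End OneVariable.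

Section Lasso.
Variable R : realType.

(* The library norm on matrices is the maximum norm. *)
Definition norm2 k (v : 'cV[R]_k) : R := Num.sqrt (\sum_(i < k) v i 0 ^+ 2).

Variables m n : nat.
Implicit Types (A : 'M[R]_(m, n)) (y : 'cV[R]_m) (lambda : R).
Implicit Types (x w z : 'cV[R]_n).

Definition weighted_lasso A y lambda w x : R :=
  2^-1 * norm2 (y - A *m x) ^+ 2 + lambda * \sum_(i < n) w i 0 * `|x i 0|.

Definition lasso_solution A y lambda w z : Prop :=
  forall x, weighted_lasso A y lambda w z <= weighted_lasso A y lambda w x.

Definition lasso_functional A y lambda (h : R -> R) x w : R :=
  2^-1 * norm2 (y - A *m x) ^+ 2
  + lambda * \sum_(i < n) (w i 0 * `|x i 0| + h (w i 0)).

(* (x, w) is a trajectory of the algorithm; the weights are only defined when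
   all the |x_i(t)| belong to the domain D of g. *)
Definition irl1_run (D : set R) (g : R -> R) A y lambda
    (x w : nat -> 'cV[R]_n) : Prop :=
  forall t : nat,
    [/\ forall i, D `|x t i 0|,
        forall i, w t i 0 = derive_in D g `|x t i 0|
      & lasso_solution A y lambda (w t) (x t.+1)].

Definition partial_optimum (X Y : set 'cV[R]_n)
    (F : 'cV[R]_n -> 'cV[R]_n -> R) x w : Prop :=
  [/\ X x, Y w,
      forall x', X x' -> F x w <= F x' w
    & forall w', Y w' -> F x w <= F x w'].

End Lasso.

(* Main.v *)
(* Limits are taken along ultrafilters G on nat finer than \oo, along which all
   bounded real sequences converge. By the duality between g and h, the function
   v |-> v u + h v on g'(D) has the unique minimizer g' u, so that F decreases
   along the run. The weights are bounded, hence converge along G to some ws in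
   the closed set Y; as ws lies in g'(D), the iterates are bounded and converge
   to some xs with ws = g' |xs|. If (x', w') is the limit along G of the shifted
   run, then x' minimizes F (., ws), and F (x', w') = F (xs, ws) since F (x t, w t)
   converges; hence w' = ws, and xs minimizes F (., ws) as well. This makes
   (xs, ws) a partial optimum with |x'| = |xs|. Finally x' = xs, so the steps tend
   to 0 along every G. *)
Require Import Defs.
From mathcomp Require Import all_boot all_order all_algebra.
From mathcomp Require Import all_classical all_reals all_analysis.
From mathcomp Require Import ring lra.

Set Implicit Arguments.
Unset Strict Implicit.

Import Order.TTheory GRing.Theory Num.Theory.
Import numFieldNormedType.Exports.

Local Open Scope classical_set_scope.
Local Open Scope ring_scope.

(** * Derivatives relative to an interval *)

Section OneVariable.
Variable R : realType.
Implicit Types (D : set R) (f g h : R -> R).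

Lemma interval_segment D (a b t : R) : is_interval D -> D a -> D b ->
  0 < t < 1 -> D (a + t * (b - a)).
Proof.
move=> Di Da Db /andP[t0 t1].
have [ab|ba] := leP a b.
  by apply: (Di a b) => //; apply/andP; split; nra.
by apply: (Di b a) => //; apply/andP; split; nra.
Qed.

Lemma derivable_in_within_cvg D f x : derivable_in D f x ->
  f @ within D (nbhs x) --> f x.
Proof.
move=> [_]; set l := lim _ => dl.
have idx : u @[u --> within D x^'] --> x.
  move=> A /= xA; rewrite /within /=.
  by apply: nbhs_dnbhs; apply: filterS xA => u Au _.
have h1 : (diff_quot f x u * (u - x) + f x) @[u --> within D x^'] --> f x.
  rewrite -[X in _ --> X]add0r -(mulr0 l).
  apply: cvgD; last exact: cvg_cst.
  apply: cvgM; first exact: dl.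
  rewrite -(subrr x); apply: cvgB; last exact: cvg_cst.
  exact: idx.
move=> A fA.
have h2 : \forall u \near x, u != x -> D u ->
    A (diff_quot f x u * (u - x) + f x) by exact: h1.
rewrite !nbhs_simpl /within /=; near=> u => Du; have [->|ux] := eqVneq u x; first exact: nbhs_singleton.
suff -> : f u = diff_quot f x u * (u - x) + f x by move: Du ux => /[swap]; near: u.
by rewrite /diff_quot divfK ?subrK// subr_eq0.
Unshelve. all: by end_near. Qed.

(** Along the segment from [x] to [z] the relative derivative becomes a right limit at 0, so that
    interior points and endpoints of [D] are treated alike. *)
Lemma derive_in_direction D f (x z : R) : is_interval D -> D x -> D z ->
  z != x -> derivable_in D f x ->
  (f (x + t * (z - x)) - f x) / t @[t --> 0^'+] --> derive_in D f x * (z - x).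
Proof.
move=> Di Dx Dz zx [_ dl].
have zx0 : z - x != 0 by rewrite subr_eq0.
have phi0 : x + t * (z - x) @[t --> 0^'+] --> x.
  rewrite -[X in _ --> X]addr0 -[X in _ --> _ + X](mul0r (z - x)).
  apply: cvgD; first exact: cvg_cst.
  apply: cvgM; last exact: cvg_cst.
  exact: cvg_within.
have phi : x + t * (z - x) @[t --> 0^'+] --> within D x^'.
  move=> A; rewrite /within /= /dnbhs /within /= => /phi0 /= H.
  rewrite !nbhs_simpl /= in H *; near=> t.
  have t0 : 0 < t by near: t; exact: nbhs_right_gt.
  have t1 : t < 1 by near: t; exact: nbhs_right_lt.
  have : x + t * (z - x) != x.
    by rewrite -subr_eq0 addrC addrA addNr add0r mulf_neq0// gt_eqF.
  have : D (x + t * (z - x)) by apply: interval_segment => //; rewrite t0.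
  by move=> /[swap]; near: t.
have {}dl := cvg_comp _ _ phi dl.
have := cvgM dl (cvg_cst (z - x)) => /(_ _ _).
apply: cvg_trans; apply: near_eq_cvg; near=> t.
have t0 : t != 0 by rewrite gt_eqF//; near: t; exact: nbhs_right_gt.
rewrite /= /diff_quot addrAC subrr add0r invfM mulrA mulfVK//.
Unshelve. all: by end_near. Qed.

Lemma derive_in_ge D f (x z c : R) : is_interval D -> D x -> D z ->
  z != x -> derivable_in D f x ->
  (forall t, 0 < t < 1 -> c * t <= f (x + t * (z - x)) - f x) ->
  c <= derive_in D f x * (z - x).
Proof.
move=> Di Dx Dz zx df H.
apply: cvgr_to_ge (derive_in_direction _ _ _ _ _) _ => //.
near=> t.
have t0 : 0 < t by near: t; exact: nbhs_right_gt.
have t1 : t < 1 by near: t; exact: nbhs_right_lt.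
by rewrite ler_pdivlMr// H// t0.
Unshelve. all: by end_near. Qed.

Lemma derive_in_le D f (x z c : R) : is_interval D -> D x -> D z ->
  z != x -> derivable_in D f x ->
  (forall t, 0 < t < 1 -> f (x + t * (z - x)) - f x <= c * t) ->
  derive_in D f x * (z - x) <= c.
Proof.
move=> Di Dx Dz zx df H.
apply: cvgr_to_le (derive_in_direction _ _ _ _ _) _ => //.
near=> t.
have t0 : 0 < t by near: t; exact: nbhs_right_gt.
have t1 : t < 1 by near: t; exact: nbhs_right_lt.
by rewrite ler_pdivrMr// H// t0.
Unshelve. all: by end_near. Qed.

End OneVariable.

(** * Strictly concave functions and the duality between [g] and [h] *)

Section ConcaveDual.
Variable R : realType.
Variables (D : set R) (g h : R -> R).
Hypothesis g_concave : strictly_concave_on D g.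
Hypothesis g_diff : forall u, D u -> derivable_in D g u.
Hypothesis h_deriv : neg_inverse_derivative D g h.

Let Di : is_interval D. Proof. by case: g_concave. Qed.
Let g' := derive_in D g.

Let supergradient_le (x z : R) : D x -> D z -> z != x ->
  g z - g x <= g' x * (z - x).
Proof.
move=> Dx Dz zx; apply: derive_in_ge => //; first exact: g_diff.
move=> t t01; have [_ /(_ z x t Dz Dx zx t01)] := g_concave.
have -> : t * z + (1 - t) * x = x + t * (z - x) by ring.
by move/ltW; lra.
Qed.

(** The non-strict inequality at the midpoint of [x] and [z] becomes strict at [z] by strict
    concavity. *)
Lemma supergradient_lt (x z : R) : D x -> D z -> z != x ->
  g z - g x < g' x * (z - x).
Proof.
move=> Dx Dz zx; have t01 : 0 < (2^-1 : R) < 1 by lra.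
have [_ /(_ z x _ Dz Dx zx t01)] := g_concave.
have Dm := interval_segment Di Dx Dz t01.
have mx : x + 2^-1 * (z - x) != x.
  by apply: contra_neq zx => zx; lra.
have -> : 2^-1 * z + (1 - 2^-1) * x = x + 2^-1 * (z - x) by lra.
have := supergradient_le Dx Dm mx; nra.
Qed.

Lemma derive_in_decr (a b : R) : D a -> D b -> a < b -> g' b < g' a.
Proof.
move=> Da Db ab.
have /(supergradient_lt Db Da)H1 : a != b by rewrite lt_eqF.
have /(supergradient_lt Da Db)H2 : b != a by rewrite gt_eqF.
(* Sum of the supergradient inequalities at [a] and at [b]. *)
have : 0 < (g' a - g' b) * (b - a) by lra.
by rewrite pmulr_lgt0 ?subr_gt0.
Qed.

Lemma derive_in_inj (a b : R) : D a -> D b -> g' a = g' b -> a = b.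
Proof.
move=> Da Db e; apply/eqP; rewrite eq_le !leNgt; apply/andP; split.
  by apply/negP => /(derive_in_decr Db Da); rewrite e ltxx.
by apply/negP => /(derive_in_decr Da Db); rewrite e ltxx.
Qed.

Lemma derive_in_le_anti (a b : R) : D a -> D b -> g' a <= g' b -> b <= a.
Proof.
move=> Da Db; apply: contraTle => ab; rewrite -ltNge.
exact: derive_in_decr.
Qed.

(* Darboux: an intermediate slope is attained at a maximum of g z - v z. *)
Lemma derive_range_interval : is_interval (derive_range D g).
Proof.
move=> _ _ [b Db <-] [a Da <-] v; rewrite -/g' => /andP[bv va].
have [e|nbv] := eqVneq (g' b) v; first by exists b.
have [e|nva] := eqVneq v (g' a); first by exists a.
have {nbv}bv : g' b < v by rewrite lt_neqAle nbv.
have {nva}va : v < g' a by rewrite lt_neqAle nva.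
have ab : a < b.
  rewrite ltNge; apply/negP; rewrite le_eqVlt => /orP[/eqP e|/(derive_in_decr Db Da)].
    by move: (lt_trans bv va); rewrite e ltxx.
  by rewrite ltNge (ltW (lt_trans bv va)).
have sub z : z \in `[a, b] -> D z by rewrite in_itv/=; exact: Di.
have cont : {within `[a, b], continuous (fun z => g z - v * z)}.
  apply: (@continuous_subspaceW _ _ _ D); first by move=> z /= /sub.
  apply/subspace_continuousP => z Dz; apply: cvgB.
    exact/derivable_in_within_cvg/g_diff.
  apply: cvgM; first exact: cvg_cst.
  exact: cvg_within.
have [c cab cmax] := EVT_max (ltW ab) cont.
have Dc := sub _ cab.
(* First-order condition at the maximizer [c], possibly one-sided. Since [g' b < v < g' a], it
   excludes both endpoints; then, taken at [z = a] and [z = b], it gives [g' c = v]. *)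
have slope z : z \in `[a, b] -> z != c -> (g' c - v) * (z - c) <= 0.
  move=> zab zc; rewrite mulrBl subr_le0.
  apply: derive_in_le => //; [exact: sub|exact: g_diff|].
  move=> t t01.
  have /cmax : c + t * (z - c) \in `[a, b].
    exact: (@interval_segment _ [set` `[a, b]%R]) (@interval_is_interval _ _) cab zab t01.
  lra.
have aI : a \in `[a, b] by rewrite in_itv/= lexx ltW.
have bI : b \in `[a, b] by rewrite in_itv/= lexx ltW.
have [e|nac] := eqVneq a c.
  have := slope b bI; rewrite -e => /(_ (negbT (gt_eqF ab))).
  by rewrite pmulr_lle0 ?subr_gt0// subr_le0 leNgt va.
have [e|nbc] := eqVneq b c.
  have := slope a aI; rewrite -e => /(_ (negbT (lt_eqF ab))).
  by rewrite nmulr_lle0 ?subr_lt0// subr_ge0 leNgt bv.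
exists c => //; apply/eqP; rewrite -/g' eq_le.
move: cab; rewrite in_itv/= => /andP[ac cb].
have := slope a aI nac; rewrite nmulr_lle0 ?subr_lt0 ?lt_neqAle ?nac// subr_ge0 => ->.
have := slope b bI nbc; rewrite pmulr_lle0 ?subr_gt0 ?lt_neqAle 1?eq_sym ?nbc// subr_le0 => ->.
by [].
Qed.

Lemma conjugate_within_cvg (v : R) : derive_range D g v ->
  h @ within (derive_range D g) (nbhs v) --> h v.
Proof. by move=> Vv; apply: derivable_in_within_cvg; case: (h_deriv Vv). Qed.

(* h (v) + u v has derivative u - (g')^-1 (v), of the sign of v - g' u. *)
Lemma conjugate_lt (u v : R) : D u -> derive_range D g v -> v != g' u ->
  g' u * u + h (g' u) < v * u + h v.
Proof.
move=> Du Vv vu.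
pose V := derive_range D g.
have Vi : is_interval V := derive_range_interval.
have Vu : V (g' u) by exists u.
(* As [V] is an interval, the whole segment between [g' u] and [v] lies in it, and [h] is
   differentiable relative to [V] there. *)
pose a := Num.min (g' u) v; pose b := Num.max (g' u) v.
have ab : a <= b by rewrite ge_min !le_max lexx.
have aI : a <= g' u <= b by rewrite ge_min le_max lexx.
have bI : a <= v <= b by rewrite ge_min le_max lexx !orbT.
have sub z : z \in `[a, b] -> V z.
  rewrite in_itv/= => abz; apply: (Vi a b) => //.
    by rewrite /a /Num.min; case: ifP.
  by rewrite /b /Num.max; case: ifP.
have cont : {within `[a, b], continuous (fun z => h z + z * u)}.
  apply: (@continuous_subspaceW _ _ _ V); first by move=> z /= /sub.
  apply/subspace_continuousP => z Vz; apply: cvgD.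
    exact: conjugate_within_cvg.
  apply: cvgM; last exact: cvg_cst.
  exact: cvg_within.
(* At a minimizer [c = g' d], moving towards [g' u] requires [(u - d) * (g' u - c) >= 0], which the
   strict decrease of [g'] allows only if [u = d]. This serves twice: for the minimizer found by
   compactness, and for [v] itself in case of equality. *)
have minE c : c \in `[a, b] ->
    (forall t, t \in `[a, b] -> h c + c * u <= h t + t * u) -> c = g' u.
  move=> cab cmin; apply/eqP/negPn/negP => cu.
  have [Dc hc] := h_deriv (sub _ cab).
  have [d Dd dc] := sub _ cab.
  have pd : pinv D (derive_in D g) c = d.
    rewrite -dc pinvKV// ?inE//.
    by move=> x y; rewrite !inE => Dx Dy; exact: derive_in_inj.
  have : - u * (g' u - c) <= derive_in V h c * (g' u - c).
    apply: derive_in_ge => //; [exact: sub|by rewrite eq_sym|].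
    move=> t t01.
    have /cmin : c + t * (g' u - c) \in `[a, b].
      exact: (@interval_segment _ [set` `[a, b]%R]) (@interval_is_interval _ _) cab aI t01.
    lra.
  rewrite hc pd -dc => H.
  have [ud|du|e] := ltgtP u d.
  - have := derive_in_decr Du Dd ud; rewrite -/g' in H *; nra.
  - have := derive_in_decr Dd Du du; rewrite -/g' in H *; nra.
  - by move: cu; rewrite -dc e eqxx.
have [c cab cmin] := EVT_min ab cont.
have ce := minE c cab cmin.
have vI : v \in `[a, b] by rewrite in_itv.
rewrite lt_neqAle; apply/andP; split; last first.
  by have := cmin _ vI; rewrite ce; lra.
apply: contra_neq vu => e; apply: minE => // t /cmin; rewrite ce; lra.
Qed.

End ConcaveDual.

(** * Limits along ultrafilters *)

Section Ultrafilters.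

Lemma ultra_fmap (T U : Type) (f : T -> U) (G : set_system T) :
  UltraFilter G -> UltraFilter (f @ G).
Proof.
move=> GU; split=> [|H HF fGH]; first exact: fmap_proper_filter.
rewrite predeqE => B; split; last exact: fGH.
move=> HB; have [//|GnB] := in_ultra_setVsetC (f @^-1` B) GU.
have HnB : H (~` B) by exact: fGH.
by have /filter_ex [? []] : H (B `&` ~` B) by exact: filterI.
Qed.

(** Compactness of the segment from [- K] to [K]; this replaces the extraction of convergent
    subsequences. *)
Lemma ultra_bounded_cvg (R : realType) (T : Type) (G : set_system T)
    (u : T -> R) (K : R) :
  UltraFilter G -> (\forall t \near G, `|u t| <= K) -> exists l : R, u @ G --> l.
Proof.
move=> GU uK; have := @segment_compact R (- K) K; rewrite compact_ultra.
move=> /(_ (u @ G) (ultra_fmap _ GU)) [|l [_ ul]]; last by exists l.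
by near=> t; rewrite /= in_itv/= -ler_norml; near: t.
Unshelve. all: by end_near. Qed.

(** As [p] is a cluster point, the members of [F] and the preimages of the neighbourhoods of [p]
    together generate a proper filter; any ultrafilter containing it will do. *)
Lemma cluster_ultra (T : Type) (S : topologicalType) (F : set_system T)
    (f : T -> S) (p : S) : Filter F -> cluster (f @ F) p ->
  exists G, [/\ UltraFilter G, F `<=` G & f @ G --> p].
Proof.
move=> FF clp.
pose B := filter_from (fun AB => F AB.1 /\ nbhs p AB.2)
  (fun AB : set T * set S => AB.1 `&` f @^-1` AB.2).
have BF : ProperFilter B.
  apply: filter_from_proper.
    apply: filter_from_filter; first by exists (setT, setT); split; exact: filterT.
    move=> [A1 B1] [A2 B2] /= [FA1 pB1] [FA2 pB2].
    exists (A1 `&` A2, B1 `&` B2); first by split; exact: filterI.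
    by move=> t /= [[? ?] [? ?]].
  move=> [A1 B1] /= [FA1 pB1].
  have : F (f @^-1` (f @` A1)) by apply: filterS FA1 => t At; exists t.
  by move=> /clp /(_ pB1) [_ [[t At <-] Bt]]; exists t.
have [G [GU BG]] := ultraFilterLemma BF.
exists G; split => // [A1 FA1|B1 pB1].
  by apply: BG; exists (A1, setT); [split=> //; exact: filterT|move=> t []].
by apply: BG; exists (setT, B1); [split=> //; exact: filterT|move=> t []].
Qed.

(** Otherwise some neighbourhood of [p] has a preimage outside [F], and [F] restricted to the
    complement of that preimage extends to an ultrafilter along which [f] does not tend to [p]. *)
Lemma cvg_ultra (T : Type) (S : topologicalType) (F : set_system T)
    (f : T -> S) (p : S) : Filter F ->
  (forall G, UltraFilter G -> F `<=` G -> f @ G --> p) -> f @ F --> p.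
Proof.
move=> FF H A pA; apply: contrapT => nFA.
have BF : ProperFilter (within (~` (f @^-1` A)) F).
  apply: Build_ProperFilter; rewrite /within /= => Fn; apply: nFA.
  suff : F (f @^-1` A) by [].
  by apply: filterS Fn => t nnA; apply: contrapT.
have [G [GU BG]] := ultraFilterLemma BF.
have FG : F `<=` G by move=> C FC; apply: BG; apply: filterS FC => t Ct _.
have GA : G (f @^-1` A) by exact: (H G GU FG A pA).
have GnA : G (~` (f @^-1` A)) by apply: BG; exact: withinT.
by have /filter_ex [? []] : G (f @^-1` A `&` ~` (f @^-1` A)) by exact: filterI.
Qed.

Lemma cvg_matrixP (R : topologicalType) (T : Type) m n (F : set_system T)
    (f : T -> 'M[R]_(m, n)) (M : 'M[R]_(m, n)) : Filter F ->
  f @ F --> M <-> forall i j, f t i j @[t --> F] --> M i j.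
Proof.
move=> FF; split=> [fM i j A MA|fM A [P MP PA]].
  have NM : nbhs M [set N : 'M[R]_(m, n) | A (N i j)].
    exists (fun i' j' => if (i' == i) && (j' == j) then A else setT).
      move=> i' j'; case: ifP => [/andP[/eqP -> /eqP ->] //|_]; exact: filterT.
    by move=> N /(_ i j); rewrite !eqxx.
  exact: (fM _ NM).
suff : F (f @^-1` A) by [].
have : \forall t \near F, forall i j, P i j (f t i j).
  by apply: filter_forall => i; apply: filter_forall => j; exact: (fM i j _ (MP i j)).
by apply: filterS => t; exact: PA.
Qed.

End Ultrafilters.

(** * The weighted lasso problem for fixed weights *)

Section Lasso.
Variables (R : realType) (m n : nat) (A : 'M[R]_(m, n)) (y : 'cV[R]_m).
Variable (lambda : R).
Hypothesis lambda_gt0 : 0 < lambda.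
Implicit Types w z d : 'cV[R]_n.

Lemma norm2_sqr k (v : 'cV[R]_k) : norm2 v ^+ 2 = \sum_(i < k) v i 0 ^+ 2.
Proof. by rewrite sqr_sqrtr// sumr_ge0// => i _; exact: sqr_ge0. Qed.

Lemma norm2B_sqr k (a b : 'cV[R]_k) (s : R) : norm2 (a - s *: b) ^+ 2 =
  norm2 a ^+ 2 - 2 * s * \sum_(i < k) a i 0 * b i 0 + s ^+ 2 * norm2 b ^+ 2.
Proof.
rewrite !norm2_sqr !mulr_sumr -sumrB -big_split/=; apply: eq_bigr => i _.
by rewrite !mxE; ring.
Qed.

(** Comparison with the competitor 0, whose penalty vanishes. *)
Lemma lasso_solution_residual w z : (forall i, 0 <= w i 0) ->
  lasso_solution A y lambda w z -> norm2 (y - A *m z) ^+ 2 <= norm2 y ^+ 2.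
Proof.
move=> w0 /(_ 0); rewrite /weighted_lasso mulmx0 subr0.
rewrite [X in _ <= _ + lambda * X]big1 => [|i _]; last by rewrite mxE normr0 mulr0.
have : 0 <= lambda * \sum_(i < n) w i 0 * `|z i 0|.
  apply: mulr_ge0; first exact: ltW.
  by apply: sumr_ge0 => i _; rewrite mulr_ge0.
lra.
Qed.

Lemma le_of_quadratic (a b c : R) : 0 <= c ->
  (forall s, 0 < s < 1 -> a * s <= b * s + c * s ^+ 2) -> a <= b.
Proof.
move=> c0 H; rewrite leNgt; apply/negP => ba.
(* Chosen in []0, 1[] with [e * c < a - b], so that at [s = e] the linear gap beats the quadratic
   term. *)
pose e := (a - b) / (a - b + c + 1).
have den : 0 < a - b + c + 1 by lra.
have e0 : 0 < e by rewrite divr_gt0// subr_gt0.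
have e1 : e < 1 by rewrite ltr_pdivrMr//; lra.
have := H e; rewrite e0 e1 => /(_ isT).
have E : e * (a - b + c + 1) = a - b by rewrite divfK// gt_eqF.
have : e * c < a - b by rewrite -E; nra.
nra.
Qed.

(* First-order optimality along the i-th coordinate axis. *)
Lemma lasso_weight_le w z i : (forall i, 0 <= w i 0) ->
  lasso_solution A y lambda w z -> z i 0 != 0 ->
  lambda * w i 0 <= norm2 y ^+ 2 + norm2 (col i A) ^+ 2.
Proof.
move=> w0 sol zi0.
have res := lasso_solution_residual w0 sol.
pose r := y - A *m z; pose c := col i A.
pose rc := \sum_(k < m) r k 0 * c k 0.
have opt : lambda * w i 0 * `|z i 0| <= z i 0 * rc.
  apply: (@le_of_quadratic _ _ (2^-1 * z i 0 ^+ 2 * norm2 c ^+ 2)).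
    by rewrite -mulrA; apply: mulr_ge0; [lra|apply: mulr_ge0; exact: sqr_ge0].
  move=> s /andP[s0 s1].
  (* The competitor multiplies the [i]-th coordinate of [z] by [1 - s]: the penalty falls by
     [s * lambda * w i 0 * |z i 0|], and the quadratic term rises by [s * z i 0 * rc] to first
     order. *)
  have := sol (z + (- s * z i 0) *: delta_mx i 0).
  rewrite /weighted_lasso mulmxDr -scalemxAr -colE opprD addrA -/r -/c.
  rewrite norm2B_sqr -/rc.
  rewrite (bigD1 i)//= [X in _ <= _ + _ * X](bigD1 i)//=.
  have -> : (z + (- s * z i 0) *: delta_mx i 0) i 0 = (1 - s) * z i 0.
    by rewrite !mxE !eqxx /=; ring.
  rewrite (eq_bigr (fun j => w j 0 * `|(z + (- s * z i 0) *: delta_mx i 0) j 0|)).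
    rewrite normrM (gtr0_norm (_ : 0 < 1 - s)) ?subr_gt0//.
    set S := \sum_(j < n | _) _.
    nra.
  by move=> j ji; rewrite !mxE (negbTE ji) mulr0 addr0.
have rc_le : `|rc| <= norm2 r ^+ 2 + norm2 c ^+ 2.
  rewrite !norm2_sqr -big_split/=; apply: le_trans (ler_norm_sum _ _ _) _.
  apply: ler_sum => k _; rewrite normrM -[X in X + _]real_normK ?num_real//.
  rewrite -[X in _ + X]real_normK ?num_real//.
  have := normr_ge0 (r k 0); have := normr_ge0 (c k 0); nra.
apply: (@le_trans _ _ `|rc|); last by apply: le_trans rc_le _; rewrite lerD2r.
rewrite -(@ler_pM2r _ `|z i 0|) ?normr_gt0// -normrM.
by apply: le_trans opt _; rewrite mulrC ler_norm.
Qed.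

(** At the midpoint of two solutions the penalty is at most the average, while the quadratic term
    lies below the average by a positive multiple of the squared norm of [A *m (z1 - z2)]. *)
Lemma lasso_solutions_image w z1 z2 : (forall i, 0 <= w i 0) ->
  lasso_solution A y lambda w z1 -> lasso_solution A y lambda w z2 ->
  A *m z1 = A *m z2.
Proof.
move=> w0 s1 s2; have e : weighted_lasso A y lambda w z1 = weighted_lasso A y lambda w z2.
  by apply/eqP; rewrite eq_le s1 s2.
pose d := z1 - z2.
have := s2 (z2 + 2^-1 *: d); have := s1 (z2 + 2^-1 *: d).
rewrite /weighted_lasso in e *.
have Az1 : y - A *m z1 = y - A *m z2 - 1 *: (A *m d).
  by rewrite scale1r /d mulmxBr opprB addrA subrK.
rewrite mulmxDr -scalemxAr opprD addrA norm2B_sqr.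
move: e; rewrite Az1 norm2B_sqr.
set N := norm2 (A *m d) ^+ 2; set P := \sum_(i < m) _.
set S1 := \sum_(i < n) _ * `|z1 _ _|; set S2 := \sum_(i < n) _ * `|z2 _ _|.
set S := \sum_(i < n) _.
have convS : S <= 2^-1 * S1 + 2^-1 * S2.
  rewrite !mulr_sumr -big_split/=; apply: ler_sum => i _.
  rewrite !mxE; have := w0 i.
  have : `|z2 i 0 + 2^-1 * (z1 i 0 - z2 i 0)| <= 2^-1 * `|z1 i 0| + 2^-1 * `|z2 i 0|.
    have -> : z2 i 0 + 2^-1 * (z1 i 0 - z2 i 0) = 2^-1 * z1 i 0 + 2^-1 * z2 i 0 by lra.
    by apply: le_trans (ler_normD _ _) _; rewrite !normrM ger0_norm; lra.
  nra.
have lS : lambda * S <= lambda * (2^-1 * S1 + 2^-1 * S2) by rewrite ler_pM2l.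
move=> e h1 h2.
have : N <= 0 by lra.
rewrite /N norm2_sqr => N0.
have {}N0 : \sum_(i < m) (A *m d) i 0 ^+ 2 = 0.
  by apply/eqP; rewrite eq_le N0 sumr_ge0// => i _; exact: sqr_ge0.
apply/subr0_eq; rewrite -mulmxBr -/d; apply/colP => i; rewrite [RHS]mxE.
have /psumr_eq0P := N0 => /(_ (fun i _ => sqr_ge0 _)) /(_ i isT) /eqP.
by rewrite sqrf_eq0 => /eqP.
Qed.

(** A shift in the kernel of [A] preserves the residual, so only the penalty matters. Together with
    uniqueness, this will force such a shift to vanish. *)
Lemma lasso_solution_shrink w z d : (forall i, 0 <= w i 0) ->
  lasso_solution A y lambda w z -> A *m d = 0 ->
  (forall i, `|z i 0 + d i 0| <= `|z i 0|) ->
  lasso_solution A y lambda w (z + d).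
Proof.
move=> w0 sol Ad dz u; apply: le_trans (sol u).
rewrite /weighted_lasso mulmxDr Ad addr0 lerD2l ler_pM2l//.
by apply: ler_sum => i _; rewrite mxE ler_wpM2l.
Qed.

Lemma weighted_lasso_cvg (T : Type) (F : set_system T) (x w : T -> 'cV[R]_n)
    (xs ws : 'cV[R]_n) : Filter F ->
  (forall i, x t i 0 @[t --> F] --> xs i 0) ->
  (forall i, w t i 0 @[t --> F] --> ws i 0) ->
  weighted_lasso A y lambda (w t) (x t) @[t --> F] -->
    weighted_lasso A y lambda ws xs.
Proof.
move=> FF xc wc; apply: cvgD; apply: cvgM; try exact: cvg_cst.
  rewrite norm2_sqr; under eq_fun do rewrite norm2_sqr.
  apply: cvg_big; [exact: add_continuous|] => k _; rewrite expr2; under eq_fun do rewrite expr2.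
  have c1 : (y - A *m x t) k 0 @[t --> F] --> (y - A *m xs) k 0.
    under eq_fun do rewrite !mxE. rewrite !mxE.
    apply: cvgB; first exact: cvg_cst.
    apply: cvg_big; [exact: add_continuous|] => j _; apply: cvgM; [exact: cvg_cst|exact: xc].
  exact: cvgM.
apply: cvg_big; [exact: add_continuous|] => i _; apply: cvgM; first exact: wc.
exact: cvg_norm.
Qed.

(** For fixed [w] the two objectives differ by a constant, hence have the same minimizers in [z]. *)
Lemma lasso_functionalE (h : R -> R) z w : lasso_functional A y lambda h z w =
  weighted_lasso A y lambda w z + lambda * \sum_(i < n) h (w i 0).
Proof.
by rewrite /lasso_functional /weighted_lasso big_split/= mulrDr addrA.
Qed.

End Lasso.

(** * Descent and boundedness along the run *)

Section Iterates.
Variables (R : realType) (m n : nat) (D : set R) (g h : R -> R).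
Variables (A : 'M[R]_(m, n)) (y : 'cV[R]_m) (lambda : R).
Variables (X Y : set 'cV[R]_n) (x w : nat -> 'cV[R]_n).
Hypothesis g_concave : strictly_concave_on D g.
Hypothesis g_diff : forall u, D u -> derivable_in D g u.
Hypothesis h_ge0 : forall v, derive_range D g v -> 0 <= h v.
Hypothesis h_deriv : neg_inverse_derivative D g h.
Hypothesis lambda_gt0 : 0 < lambda.
Hypothesis Y_dom :
  forall v, Y v -> forall i, 0 <= v i 0 /\ derive_range D g (v i 0).
Hypothesis X_closed : closed X.
Hypothesis Y_closed : closed Y.
Hypothesis run : irl1_run D g A y lambda x w.
Hypothesis run_XY : forall t, X (x t.+1) /\ Y (w t.+1).
Hypothesis lasso_unique : forall t, exists! z, lasso_solution A y lambda (w t) z.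

Let V := derive_range D g.
Let F := lasso_functional A y lambda h.

(** The functional splits over the coordinates, and [conjugate_lt] settles each of them. The
    equality case later identifies the limit weights. *)
Lemma weights_optimal (z u v : 'cV[R]_n) :
  (forall i, D `|z i 0|) -> (forall i, u i 0 = derive_in D g `|z i 0|) ->
  (forall i, V (v i 0)) -> F z u <= F z v ?= iff (v == u).
Proof.
move=> Dz uE Vv.
have le i : u i 0 * `|z i 0| + h (u i 0) <= v i 0 * `|z i 0| + h (v i 0)
    ?= iff (v i 0 == u i 0).
  have [->|vu] := eqVneq (v i 0) (u i 0); first exact/leif_refl.
  rewrite uE in vu *; have lt := conjugate_lt g_concave g_diff h_deriv (Dz i) (Vv i) vu.
  by split; [exact: ltW|rewrite lt_eqF].
have := leif_sum (fun i (_ : xpredT i) => le i).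
move=> [s1 s2]; split; first by rewrite lerD2l ler_pM2l.
rewrite /F /lasso_functional (inj_eq (addrI _)) (inj_eq (mulfI (lt0r_neq0 lambda_gt0))) s2.
apply/forallP/eqP => [e|-> i]; last by rewrite eqxx implybT.
by apply/colP => i; apply/eqP; have := e i.
Qed.

Lemma run_weights_range t i : V (w t i 0).
Proof. by have [Dx -> _] := run t; exists `|x t i 0|. Qed.

Lemma run_weights_ge0 t i : 0 <= w t.+1 i 0.
Proof. by have [_ /Y_dom /(_ i) []] := run_XY t. Qed.

(** Alternating minimization: [F (x t.+1) (w t)] lies between the two sides. *)
Lemma run_decreases t : F (x t.+1) (w t.+1) <= F (x t) (w t).
Proof.
have [_ _ sol] := run t; have [Dx wE _] := run t.+1.
apply: le_trans (weights_optimal Dx wE (run_weights_range t)) _.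
by rewrite /F !lasso_functionalE lerD2r.
Qed.

Lemma run_functional_cvg : exists l : R, F (x t) (w t) @[t --> \oo] --> l.
Proof.
(* [run_weights_ge0] covers only the indices from 1 on, whence the shift. *)
suff /cvg_ex[/= l Fl] : cvgn (fun t => F (x t.+1) (w t.+1)).
  by exists l; rewrite -cvg_shiftS.
apply: nonincreasing_is_cvgn.
  by apply/nonincreasing_seqP => t; exact: run_decreases.
exists 0 => _ [t _ <-]; rewrite /F /lasso_functional addr_ge0//.
  by rewrite mulr_ge0 ?sqr_ge0//; lra.
apply: mulr_ge0; first exact: ltW.
apply: sumr_ge0 => i _; rewrite addr_ge0 ?mulr_ge0 ?run_weights_ge0//.
exact/h_ge0/run_weights_range.
Qed.

(* If 0 is not in D, then no coordinate vanishes and the first-order condition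
   of the lasso problem bounds the weights; otherwise g' 0 does. *)
Lemma run_weights_bounded : exists K : R, forall t i, w t.+1 i 0 <= K.
Proof.
have [D0|D0] := pselect (D 0).
  exists (derive_in D g 0) => t i.
  have [Dx -> _] := run t.+1.
  have [-> //|x0] := eqVneq `|x t.+1 i 0| 0.
  by apply/ltW/derive_in_decr => //; rewrite lt_neqAle eq_sym x0/=.
exists ((norm2 y ^+ 2 + \sum_(i < n) norm2 (col i A) ^+ 2) / lambda) => t i.
rewrite ler_pdivlMr// mulrC.
(* The solution for the weights [w t.+1] is [x t.+2], whose coordinates have absolute values in [D]
   by the next step of the run. *)
have [_ _ sol] := run t.+1; have [Dx _ _] := run t.+2.
have x0 : x t.+2 i 0 != 0.
  by apply/eqP => xi; have := Dx i; rewrite xi normr0.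
apply: le_trans (lasso_weight_le lambda_gt0 (run_weights_ge0 t) sol x0) _.
rewrite lerD2l (bigD1 i)//= lerDl sumr_ge0// => k _; exact: sqr_ge0.
Qed.

(** * Limits of the run along an ultrafilter *)

Section AlongUltrafilter.
Variable G : set_system nat.
Hypothesis GU : UltraFilter G.
Hypothesis Goo : \oo `<=` G.

Lemma conjugate_cvg (u : nat -> R) (v : R) : (forall t, V (u t)) -> V v ->
  u @ G --> v -> h (u t) @[t --> G] --> h v.
Proof.
move=> Vu Vv uv.
have uV : u @ G --> within V (nbhs v).
  move=> B /= vB; suff GB : G (u @^-1` B) by exact: GB.
  have : G (u @^-1` [set r | V r -> B r]) by exact: uv.
  by apply: filterS => t; apply.
exact: (cvg_comp _ _ uV (conjugate_within_cvg h_deriv Vv)).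
Qed.

Lemma functional_cvg (xs ws : 'cV[R]_n) (z u : nat -> 'cV[R]_n) :
  (forall t i, V (u t i 0)) -> (forall i, V (ws i 0)) ->
  (forall i, z t i 0 @[t --> G] --> xs i 0) ->
  (forall i, u t i 0 @[t --> G] --> ws i 0) ->
  F (z t) (u t) @[t --> G] --> F xs ws.
Proof.
move=> Vu Vw zx uw; rewrite /F lasso_functionalE.
under eq_fun do rewrite lasso_functionalE.
apply: cvgD; first exact: weighted_lasso_cvg.
apply: cvgM; first exact: cvg_cst.
apply: cvg_big; [exact: add_continuous|] => i _.
by apply: conjugate_cvg.
Qed.

(* As g' is decreasing, this bounds |x t i 0| above by an element of D. *)
Lemma eventually_bounded_below (u : nat -> R) (v : R) : (forall t, V (u t)) ->
  V v -> u @ G --> v ->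
  exists2 b, D b & \forall t \near G, derive_in D g b <= u t.
Proof.
move=> Vu [c Dc cv] uv.
(* If no slope lies below [v], then [v = g' c] is the least one and [c] works for every [t]. *)
have [[b [Db bv]]|nb] := pselect (exists b, D b /\ derive_in D g b < v).
  exists b => //; near=> t; apply: ltW; near: t; exact: (cvgr_gt _ uv).
exists c => //; near=> t; rewrite cv leNgt; apply/negP => ut; apply: nb.
by have [b Db bu] := Vu t; exists b; rewrite bu.
Unshelve. all: by end_near. Qed.

(** This bounds [|x t i 0|] below by an element of [D]. Both bounds keep the limit inside the
    interval [D], which need not be closed. *)
Lemma eventually_bounded_above (u : nat -> R) (v : R) : (forall t, V (u t)) ->
  V v -> u @ G --> v ->
  exists2 b, D b & \forall t \near G, u t <= derive_in D g b.
Proof.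
move=> Vu [c Dc cv] uv.
have [[b [Db bv]]|nb] := pselect (exists b, D b /\ v < derive_in D g b).
  exists b => //; near=> t; apply: ltW; near: t; exact: (cvgr_lt _ uv).
exists c => //; near=> t; rewrite cv leNgt; apply/negP => ut; apply: nb.
by have [b Db bu] := Vu t; exists b; rewrite bu.
Unshelve. all: by end_near. Qed.

Lemma iterates_limit : exists xs ws : 'cV[R]_n,
  [/\ forall i, x t i 0 @[t --> G] --> xs i 0,
      forall i, w t i 0 @[t --> G] --> ws i 0,
      X xs /\ Y ws,
      forall i, D `|xs i 0| &
      forall i, ws i 0 = derive_in D g `|xs i 0| ].
Proof.
have [Di _] := g_concave.
have near_pos (P : set nat) : (forall t, P t.+1) -> G P.
  by move=> PS; apply: Goo; exists 1%N => // -[].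
have [K wK] := run_weights_bounded.
have /choice[ws' wsP] : forall i, exists l : R, w t i 0 @[t --> G] --> l.
  move=> i; apply: (@ultra_bounded_cvg _ _ _ _ K) => //.
  by apply: near_pos => t; rewrite ger0_norm// run_weights_ge0.
pose ws : 'cV[R]_n := \col_i ws' i.
have wc i : w t i 0 @[t --> G] --> ws i 0 by rewrite mxE; exact: wsP.
have Yws : Y ws.
  apply: (@closed_cvg _ _ G _ w Y Y_closed).
    by apply: near_pos => t; have [] := run_XY t.
  by apply/cvg_matrixP => i j; rewrite ord1; exact: wc.
have Vw i : V (ws i 0) by have /Y_dom/(_ i)[] := Yws.
have xb i : exists2 ab, D ab.1 /\ D ab.2 &
    \forall t \near G, ab.1 <= `|x t i 0| <= ab.2.
  have wV t : V (w t i 0) by exact: run_weights_range.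
  have [b Db bw] := eventually_bounded_below wV (Vw i) (wc i).
  have [a Da aw] := eventually_bounded_above wV (Vw i) (wc i).
  exists (a, b) => //=; near=> t; have [Dx wE _] := run t.
  have bt : derive_in D g b <= w t i 0 by near: t.
  have ta : w t i 0 <= derive_in D g a by near: t.
  rewrite wE in bt ta.
  by rewrite (derive_in_le_anti g_concave g_diff (Dx i) Da ta)
             (derive_in_le_anti g_concave g_diff Db (Dx i) bt).
have /choice[xs' xsP] : forall i, exists l : R, x t i 0 @[t --> G] --> l.
  move=> i; have [[a b] /= [Da Db] ab] := xb i.
  by apply: (@ultra_bounded_cvg _ _ _ _ b); near=> t;
    have /andP[] : a <= `|x t i 0| <= b by near: t.
pose xs : 'cV[R]_n := \col_i xs' i.
have xc i : x t i 0 @[t --> G] --> xs i 0 by rewrite mxE; exact: xsP.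
have xn i : `|x t i 0| @[t --> G] --> `|xs i 0| by apply: cvg_norm; exact: xc.
have Dxs i : D `|xs i 0|.
  have [[a b] /= [Da Db] ab] := xb i.
  apply: (Di a b) => //; apply/andP; split.
    by apply: cvgr_to_ge (xn i) _; apply: filterS ab => t /andP[].
  by apply: cvgr_to_le (xn i) _; apply: filterS ab => t /andP[].
exists xs, ws; split => //.
  split=> //; apply: (@closed_cvg _ _ G _ x X X_closed).
    by apply: near_pos => t; have [] := run_XY t.
  by apply/cvg_matrixP => i j; rewrite ord1; exact: xc.
(* In place of continuity of [g'], the minimality of [w t i 0] for [|x t i 0|] is passed to the
   limit, against the strict inequality at [|xs i 0|]. *)
move=> i; apply/eqP/negPn/negP => ne.
have := conjugate_lt g_concave g_diff h_deriv (Dxs i) (Vw i) ne.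
set v := derive_in D g `|xs i 0|.
rewrite ltNge => /negP; apply.
apply: (@ler_cvg_to nat G _ R (fun t => w t i 0 * `|x t i 0| + h (w t i 0))
  (fun t => v * `|x t i 0| + h v)).
- apply: cvgD; first by apply: cvgM; [exact: wc|exact: xn].
  by apply: conjugate_cvg => // t; exact: run_weights_range.
- apply: cvgD; last exact: cvg_cst.
  by apply: cvgM; [exact: cvg_cst|exact: xn].
near=> t; have [Dx wE _] := run t; rewrite wE.
have [->//|ne'] := eqVneq v (derive_in D g `|x t i 0|).
by apply/ltW/conjugate_lt => //; exists `|xs i 0|.
Unshelve. all: by end_near. Qed.

End AlongUltrafilter.

(* Unlike the uniqueness at w t, uniqueness for the limit weights ws is not
   assumed: x' and xs differ at most by signs, and moving x t.+1 from the
   vicinity of x' towards xs would not increase the objective at w t. *)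
Lemma iterates_limit_step (G : set_system nat) (xs ws : 'cV[R]_n) :
  UltraFilter G -> \oo `<=` G ->
  (forall i, x t i 0 @[t --> G] --> xs i 0) ->
  (forall i, w t i 0 @[t --> G] --> ws i 0) ->
  [/\ partial_optimum X Y F xs ws,
      forall i, x t.+1 i 0 @[t --> G] --> xs i 0 &
      forall i, w t.+1 i 0 @[t --> G] --> ws i 0].
Proof.
move=> GU Goo xc wc.
have GSU : UltraFilter (succn @ G) by exact: ultra_fmap.
have GSoo : \oo `<=` succn @ G.
  move=> B [N _ NB]; apply: Goo; exists N => // k /= Nk.
  by apply: NB; rewrite /= leqW.
have [xs0 [ws0 [xc0 wc0 [Xxs Yws] Dxs wsE]]] := iterates_limit GU Goo.
have exs : xs0 = xs.
  by apply/colP => i; exact: cvg_unique (xc0 i) (xc i).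
have ews : ws0 = ws.
  by apply/colP => i; exact: cvg_unique (wc0 i) (wc i).
subst xs0 ws0; clear xc0 wc0.
have [x' [w' [xc' wc' [_ Yw'] Dx' w'E]]] := iterates_limit GSU GSoo.
have {}xc' i : x t.+1 i 0 @[t --> G] --> x' i 0 by exact: xc'.
have {}wc' i : w t.+1 i 0 @[t --> G] --> w' i 0 by exact: wc'.
have Vws i : V (ws i 0) by rewrite wsE; exists `|xs i 0|.
have Vw' i : V (w' i 0) by rewrite w'E; exists `|x' i 0|.
have FE : F xs ws = F x' w'.
  have [l Fl] := run_functional_cvg.
  have c1 : F (x t) (w t) @[t --> G] --> F xs ws.
    by apply: functional_cvg => //; exact: run_weights_range.
  have c2 : F (x t.+1) (w t.+1) @[t --> G] --> F x' w'.
    by apply: functional_cvg => // t; exact: run_weights_range.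
  have l1 : F (x t) (w t) @[t --> G] --> l.
    by move=> B /Fl; exact: Goo.
  have l2 : F (x t.+1) (w t.+1) @[t --> G] --> l.
    by move=> B /Fl; exact: GSoo.
  exact: etrans (cvg_unique _ c1 l1) (esym (cvg_unique _ c2 l2)).
have sol' : lasso_solution A y lambda ws x'.
  move=> z; apply: (@ler_cvg_to nat G _ R
    (fun t => weighted_lasso A y lambda (w t) (x t.+1))
    (fun t => weighted_lasso A y lambda (w t) z)).
  - exact: weighted_lasso_cvg.
  - by apply: weighted_lasso_cvg => // i; exact: cvg_cst.
  - by near=> t; have [_ _] := run t; exact.
(* The chain [F x' w' <= F x' ws <= F xs ws = F x' w'] collapses: its first equality gives
   [w' = ws], its second makes [xs] a solution for [ws]. *)
have F1 : F x' ws <= F xs ws by rewrite /F !lasso_functionalE lerD2r.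
have [F2 F2E] := weights_optimal Dx' w'E Vws.
have FE' : F x' w' = F x' ws by apply/eqP; rewrite eq_le F2 -FE F1.
have ww : w' = ws by move/eqP: FE'; rewrite F2E => /eqP.
have sol : lasso_solution A y lambda ws xs.
  move=> z; apply: le_trans (sol' z).
  by move: FE'; rewrite -FE /F !lasso_functionalE => /addIr ->.
have absE i : `|xs i 0| = `|x' i 0|.
  by apply: (derive_in_inj g_concave g_diff) => //; rewrite -wsE -w'E ww.
have ws0 i : 0 <= ws i 0 by have /Y_dom/(_ i)[] := Yws.
have Axx : A *m xs = A *m x' by exact: lasso_solutions_image ws0 sol sol'.
have xx : xs = x'.
  (* Where the coordinates differ, [xs = - x'] and [d = - x' / 2]; an iterate closer to [x'] than
     [|x'| / 2] has the sign of [x'], and adding [d] moves it towards 0 without crossing it. *)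
  pose d := 4^-1 *: (xs - x').
  have near_x' : \forall t \near G, forall i,
      `|x t.+1 i 0 + d i 0| <= `|x t.+1 i 0|.
    apply: filter_forall => i; rewrite /d !mxE.
    have [->|ne] := eqVneq (xs i 0) (x' i 0).
      by near=> t; rewrite subrr mulr0 addr0.
    have x'0 : 0 < `|x' i 0|.
      rewrite normr_gt0; apply: contra_neq ne => x0.
      by have := absE i; rewrite x0 normr0 => /normr0_eq0.
    have xN : xs i 0 = - x' i 0.
      have /eqP := absE i; rewrite eqr_norm2 (negbTE ne)/= => /eqP //.
    near=> t.
    have : `|x' i 0 - x t.+1 i 0| < 2^-1 * `|x' i 0|.
      near: t; apply: (cvgr_dist_lt _ _ (xc' i)); lra.
    rewrite xN; move: (x' i 0) (x t.+1 i 0) => a b.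
    have [a0|a0] := ltP 0 a.
      rewrite (gtr0_norm a0) ltr_distl => /andP[b1 b2].
      by rewrite !ger0_norm; lra.
    rewrite (ler0_norm a0) ltr_distl => /andP[b1 b2].
    by rewrite !ler0_norm; lra.
  (* [t] is taken positive so that [w t] is known to be nonnegative. *)
  have [t [t1 td]] : exists t, (0 < t)%N /\ forall i,
      `|x t.+1 i 0 + d i 0| <= `|x t.+1 i 0|.
    near G => t; exists t; split; near: t => //.
    by apply: Goo; exact: nbhs_infty_gt.
  case: t t1 td => // t _ td.
  have [_ _ solt] := run t.+1.
  have Ad : A *m d = 0 by rewrite /d -scalemxAr mulmxBr Axx subrr scaler0.
  have solt' := lasso_solution_shrink lambda_gt0 (run_weights_ge0 t) solt Ad td.
  (* Both [x t.+2] and [x t.+2 + d] solve the problem for [w t.+1], so [d = 0]. *)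
  have [z [_ zU]] := lasso_unique t.+1.
  have : x t.+2 + d = x t.+2 by rewrite -(zU _ solt') -(zU _ solt).
  move/(canRL (addKr _)); rewrite addNr => /eqP.
  by rewrite scaler_eq0 subr_eq0 invr_eq0 pnatr_eq0/= => /eqP.
split; rewrite ?xx -?ww//.
rewrite -xx ww; split => //.
  by move=> z _; rewrite /F !lasso_functionalE lerD2r.
by move=> v /Y_dom Yv; apply: (weights_optimal Dxs wsE) => i; have [] := Yv i.
Unshelve. all: by end_near. Qed.

End Iterates.

Theorem theorem2 (R : realType) (m n : nat)
    (D : set R) (g h : R -> R)
    (A : 'M[R]_(m, n)) (y : 'cV[R]_m) (lambda : R)
    (X Y : set 'cV[R]_n) (x w : nat -> 'cV[R]_n)
    (D_ge0 : forall u, D u -> 0 <= u)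
    (g_concave : strictly_concave_on D g)
    (g_incr : strictly_increasing_on D g)
    (g_diff : forall u, D u -> derivable_in D g u)
    (h_ge0 : forall v, derive_range D g v -> 0 <= h v)
    (h_deriv : neg_inverse_derivative D g h)
    (lambda_gt0 : 0 < lambda)
    (Y_dom : forall v, Y v -> forall i, 0 <= v i 0 /\ derive_range D g (v i 0))
    (X_closed : closed X) (Y_closed : closed Y)
    (run : irl1_run D g A y lambda x w)
    (run_XY : forall t, X (x t.+1) /\ Y (w t.+1))
    (lasso_unique : forall t, exists! z, lasso_solution A y lambda (w t) z) :
  (cluster ((x t, w t) @[t --> \oo]) !=set0 /\
   forall xs ws, cluster ((x t, w t) @[t --> \oo]) (xs, ws) ->
     partial_optimum X Y (lasso_functional A y lambda h) xs ws) /\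
  norm2 (col_mx (x t.+1) (w t.+1) - col_mx (x t) (w t)) @[t --> \oo] --> (0 : R).
Proof.
pose limit := iterates_limit g_concave g_diff h_deriv lambda_gt0 Y_dom
  X_closed Y_closed run run_XY.
pose step := iterates_limit_step g_concave g_diff h_ge0 h_deriv lambda_gt0
  Y_dom X_closed Y_closed run run_XY lasso_unique.
split; [split|].
(* The limit along any ultrafilter finer than [\oo] is a cluster point. *)
- have [G [GU Goo]] := ultraFilterLemma (eventually_filter : ProperFilter \oo).
  have [xs [ws [xc wc _ _ _]]] := limit G GU Goo.
  exists (xs, ws) => P Q ooP pQ.
  have xw : (x t, w t) @[t --> G] --> (xs, ws).
    have xG : x @ G --> xs by apply/cvg_matrixP => i j; rewrite ord1; exact: xc.
    have wG : w @ G --> ws by apply/cvg_matrixP => i j; rewrite ord1; exact: wc.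
    exact: cvg_pair xG wG.
  have GP : ((x t, w t) @[t --> G]) P by exact: Goo.
  exact: filter_ex (filterI GP (xw _ pQ)).
- move=> xs ws /cluster_ultra[G [GU Goo xw]].
  have xG : x @ G --> xs by exact: (cvg_comp _ _ xw cvg_fst).
  have wG : w @ G --> ws by exact: (cvg_comp _ _ xw cvg_snd).
  move/cvg_matrixP in xG; move/cvg_matrixP in wG.
  by have [] := step G xs ws GU Goo (xG^~ 0) (wG^~ 0).
(* The limit [(xs, ws)] may depend on [G], but the run and its shift share it, so the steps tend to
   0 along each [G]. *)
apply: cvg_ultra => G GU Goo.
have [xs [ws [xc wc _ _ _]]] := limit G GU Goo.
have [_ xc' wc'] := step G xs ws GU Goo xc wc.
rewrite /norm2 -[X in _ --> X]sqrtr0; apply: continuous_cvg.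
  exact: sqrt_continuous.
rewrite [X in _ --> X](_ : _ = \sum_(i < n + n) (0 : R)); last by rewrite big1.
apply: cvg_big; [exact: add_continuous|] => i _.
rewrite -[X in _ --> X](mulr0 0).
under eq_fun do rewrite expr2.
suff c : (col_mx (x t.+1) (w t.+1) - col_mx (x t) (w t)) i 0 @[t --> G] --> (0 : R).
  exact: cvgM.
rewrite -(splitK i); case: (fintype.split i) => j /=.
  under eq_fun do rewrite mxE [X in _ + X]mxE !col_mxEu.
  rewrite -(subrr (xs j 0)); apply: cvgB; [exact: xc'|exact: xc].
under eq_fun do rewrite mxE [X in _ + X]mxE !col_mxEd.
rewrite -(subrr (ws j 0)); apply: cvgB; [exact: wc'|exact: wc].
Qed.
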